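(* Suppose $f$ belongs to the Dirichlet space $\mathcal{D}=\mathcal{D}_2$ of the unit ball $\mathbb{B}^2$ and $\mathrm{cap}_2(\mathcal{Z}(f^* ))>0$. Then $f$ is not cyclic in $\mathcal{D}$.
   Context: Let $\mathbb{B}^2=\{(z_1,z_2)\in\mathbb{C}^2: |z_1|^2+|z_2|^2<1\}$, let $\mathbb{S}^2=\partial\mathbb{B}^2$ be the unit sphere, and let $\langle z,w\rangle=z_1\overline{w}_1+z_2\overline{w}_2$. The Dirichlet space $\mathcal{D}=\mathcal{D}_2$ consists of the analytic functions $f(z_1,z_2)=\sum_{k,l\ge 0}a_{k,l}z_1^kz_2^l$ on $\mathbb{B}^2$ with $$\|f\|_2^2=\sum_{k=0}^\infty\sum_{l=0}^\infty(2+k+l)^2\frac{k!\,l!}{(1+k+l)!}|a_{k,l}|^2<\infty.$$ A function $f\in\mathcal{D}$ is cyclic in $\mathcal{D}$ if the closed linear span in $\mathcal{D}$ of $\{z_1^kz_2^lf: k,l=0,1,2,\dots\}$ is all of $\mathcal{D}$. $f^*$ denotes the radial limit function $f^*(\zeta)=\lim_{r\to1^-}f(r\zeta)$, defined at those $\zeta\in\mathbb{S}^2$ where the limit exists, and $\mathcal{Z}(f^* )\subset\mathbb{S}^2$ is its zero set, i.e. the set of $\zeta\in\mathbb{S}^2$ at which the radial limit exists and equals $0$. For a Borel probability measure $\mu$ on $\mathbb{S}^2$, its Riesz $2$-energy is $$I_2[\mu]=\int_{\mathbb{S}^2}\int_{\mathbb{S}^2}\log\frac{e}{|1-\langle\zeta,\eta\rangle|}\,d\mu(\zeta)\,d\mu(\eta)\in(0,\infty].$$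 For a Borel set $E\subset\mathbb{S}^2$, $\mathrm{cap}_2(E)=\bigl(\inf\{I_2[\mu]:\mu\in\mathcal{P}(E)\}\bigr)^{-1}$, where $\mathcal{P}(E)$ is the set of Borel probability measures supported in $E$; $\mathrm{cap}_2(E)=0$ means that no probability measure supported in $E$ has finite energy $I_2$. *)

(* Defs.v *)
From HB Require Import structures.
From mathcomp Require Import all_boot all_order all_algebra.
From mathcomp Require Import complex.
From mathcomp Require Import all_classical all_reals all_analysis.

Set Implicit Arguments.
Unset Strict Implicit.
Unset Printing Implicit Defensive.

Import Order.TTheory GRing.Theory Num.Theory numFieldNormedType.Exports.

Local Open Scope classical_set_scope.
Local Open Scope complex_scope.
Local Open Scope ring_scope.

(* The library puts its topology on [K^o] rather than on [K] for a concrete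
   field [K]; [R[i]^o] is [R[i]] with the topology of the modulus. *)
Notation Cplx R := (R[i]^o)%type.
Notation Cplx2 R := (Cplx R * Cplx R)%type.

(* [`|z|] lives in [R[i]]; this is the modulus as an element of [R]. *)
Notation cmod := ComplexField.Normc.normc.

Definition hinner (R : realType) (z w : Cplx2 R) : R[i] :=
  z.1 * conjc w.1 + z.2 * conjc w.2.

Definition unit_ball (R : realType) : set (Cplx2 R) :=
  [set z | cmod z.1 ^+ 2 + cmod z.2 ^+ 2 < 1].

Definition unit_sphere (R : realType) : set (Cplx2 R) :=
  [set z | cmod z.1 ^+ 2 + cmod z.2 ^+ 2 = 1].

(* Functions on the ball are represented by total functions on [C^2]; every
   notion below only depends on the values taken on the open unit ball. *)

(* [f] is analytic on the ball with Taylor coefficients [a]: the double power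
   series converges absolutely to [f z] at every [z] in the ball.  Given
   absolute convergence, summing over squares of indices loses nothing. *)
Definition has_taylor (R : realType) (f : Cplx2 R -> Cplx R)
    (a : nat -> nat -> Cplx R) : Prop :=
  forall z, unit_ball z ->
    (\esum_(kl in [set: nat * nat])
       (cmod (a kl.1 kl.2 * z.1 ^+ kl.1 * z.2 ^+ kl.2))%:E < +oo)%E /\
    ((\sum_(k < n) \sum_(l < n) a k l * z.1 ^+ k * z.2 ^+ l : Cplx R)
       @[n --> \oo] --> f z).

Definition coef_norm2 (R : realType) (a : nat -> nat -> Cplx R) : \bar R :=
  (\esum_(kl in [set: nat * nat])
     ((2 + kl.1 + kl.2)%:R ^+ 2 * (kl.1`! * kl.2`!)%:R
       / ((1 + kl.1 + kl.2)`!)%:R * cmod (a kl.1 kl.2) ^+ 2)%:E)%E.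

Definition dirichlet (R : realType) : set (Cplx2 R -> Cplx R) :=
  [set f | exists2 a, has_taylor f a & (coef_norm2 a < +oo)%E].

(* The squared norm of a function.  Taylor coefficients are unique, so the
   infimum is over one value, or over none (giving [+oo]) if [f] is not
   analytic on the ball. *)
Definition dirichlet_norm2 (R : realType) (f : Cplx2 R -> Cplx R) : \bar R :=
  ereal_inf [set coef_norm2 a | a in has_taylor f].

Definition monomial_multiples (R : realType) (f : Cplx2 R -> Cplx R) :
    set (Cplx2 R -> Cplx R) :=
  [set (fun z => z.1 ^+ kl.1 * z.2 ^+ kl.2 * f z) | kl in [set: nat * nat]].

Definition linear_span (R : realType) (A : set (Cplx2 R -> Cplx R)) :
    set (Cplx2 R -> Cplx R) :=
  [set h | exists (n : nat) (c : 'I_n -> Cplx R)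
             (u : 'I_n -> Cplx2 R -> Cplx R),
      (forall i, A (u i)) /\ h = (fun z => \sum_i c i * u i z)].

Definition dirichlet_closure (R : realType) (A : set (Cplx2 R -> Cplx R)) :
    set (Cplx2 R -> Cplx R) :=
  [set g | @dirichlet R g /\
     forall eps : R, 0 < eps ->
       exists2 h, A h &
         (dirichlet_norm2 (fun z => (g z - h z)%R) < (eps ^+ 2)%:E)%E].

Definition cyclic_vector (R : realType) (f : Cplx2 R -> Cplx R) : Prop :=
  dirichlet_closure (linear_span (monomial_multiples f)) = @dirichlet R.

Definition radial_limit_zeros (R : realType) (f : Cplx2 R -> Cplx R) :
    set (Cplx2 R) :=
  [set z | unit_sphere z /\
     f (r%:C * z.1, r%:C * z.2) @[r --> (1 : R)^'-] --> (0 : Cplx R)].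

(* [C^2] with its Borel sigma-algebra. *)
Notation BorelC2 R := (g_sigma_algebraType (@open (Cplx2 R))).

(* [log (e / |1 - <z, w>|)], with value [+oo] where [1 - <z, w> = 0]. *)
Definition riesz_kernel (R : realType) (z w : Cplx2 R) : \bar R :=
  if 1 - hinner z w == 0 then +oo%E
  else (ln (expR 1 / cmod (1 - hinner z w)))%:E.

Definition riesz_energy (R : realType) (mu : probability (BorelC2 R) R) :
    \bar R :=
  (\int[mu]_(z in @unit_sphere R) \int[mu]_(w in @unit_sphere R)
     riesz_kernel z w)%E.

(* A Borel probability measure on a subset [E] of the sphere is a Borel
   probability measure on [C^2] carried by [E]; for Borel [E] the condition
   says [mu E = 1]. *)
Definition probabilities_on (R : realType) (E : set (Cplx2 R)) :
    set (probability (BorelC2 R) R) :=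
  [set mu : probability (BorelC2 R) R | {ae mu, forall z : BorelC2 R, E z}].

(* The inverse on [\bar R] satisfies [+oo^-1 = 0], so the capacity is 0 if no
   measure carried by [E] has finite energy. *)
Definition cap2 (R : realType) (E : set (Cplx2 R)) : \bar R :=
  ((ereal_inf [set riesz_energy mu | mu in probabilities_on E])^-1)%E.

(* Main.v *)
(* Let [mu] be a probability measure of finite energy carried by the zero set
   of the radial limits, let [h = p f] with [p] a polynomial, and let
   [g = 1 - h] have small norm.  As [r -> 1], [g (r z) -> 1] for [mu]-almost
   every [z], so Fatou's lemma bounds [1] by the liminf of the integrals of the
   positive part of [Re g (r z)].  By duality these integrals are at most a
   constant times the norm of [g]: the inverse weights of the norm are the
   coefficients of the kernel [\sum_m (m + 1) / (m + 2)^2 <z, w>^m], whose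
   partial sums are dominated by [log (e / |1 - <z, w>|)], so the constant is
   controlled by the energy of [mu].  Hence [g] cannot have arbitrarily small
   norm, and [1] is not in the closed span. *)

Require Import Defs.
From HB Require Import structures.
From mathcomp Require Import all_boot all_order all_algebra.
From mathcomp Require Import complex.
From mathcomp Require Import all_classical all_reals all_analysis.
From mathcomp Require Import measurable_realfun.
From mathcomp Require Import ring lra zify.

Set Implicit Arguments.
Unset Strict Implicit.
Unset Printing Implicit Defensive.

Import Order.TTheory GRing.Theory Num.Theory numFieldNormedType.Exports.

Local Open Scope classical_set_scope.
Local Open Scope complex_scope.
Local Open Scope ring_scope.

(** * Partial sums of the kernel against the logarithm *)

Section kernel_bound.
Variable R : realType.
Implicit Types (x y : R[i]) (m n : nat).

Local Notation md z := (cmod z : R).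

Lemma cmodD x y : md (x + y) <= md x + cmod y.
Proof. exact: le_normcD. Qed.

Lemma cmodN x : md (- x) = md x.
Proof. exact: normcN. Qed.

Lemma cmodX x n : md (x ^+ n) = md x ^+ n.
Proof.
elim: n => [|n IH]; first by rewrite !expr0 ComplexField.Normc.normc1.
by rewrite !exprS ComplexField.Normc.normcM IH.
Qed.

Lemma cmod_ge0 x : 0 <= md x.
Proof. by case: x => a b; exact: sqrtr_ge0. Qed.

Lemma cmod_real (r : R) : cmod r%:C = `|r|.
Proof. by rewrite /= expr0n addr0 sqrtr_sqr. Qed.

Lemma sqr_cmod x : md x ^+ 2 = complex.Re x ^+ 2 + complex.Im x ^+ 2.
Proof. by case: x => a b /=; rewrite sqr_sqrtr// addr_ge0 ?sqr_ge0. Qed.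

Lemma Re_le_cmod x : `|complex.Re x| <= md x.
Proof.
by case: x => a b /=; rewrite -sqrtr_sqr ler_wsqrtr// lerDl sqr_ge0.
Qed.

Lemma Im_le_cmod x : `|complex.Im x| <= md x.
Proof.
by case: x => a b /=; rewrite -sqrtr_sqr ler_wsqrtr// lerDr sqr_ge0.
Qed.

Lemma cmod_conj x : md (conjc x) = md x.
Proof. by case: x => a b /=; rewrite sqrrN. Qed.

Definition kernel_coef m : R := m.+1%:R / m.+2%:R ^+ 2.

Lemma kernel_coef_ge0 m : 0 <= kernel_coef m.
Proof. by rewrite divr_ge0// exprn_ge0. Qed.

Lemma kernel_coef_decr m : kernel_coef m.+1 <= kernel_coef m.
Proof.
rewrite /kernel_coef ler_pdivrMr ?exprn_gt0// mulrAC ler_pdivlMr ?exprn_gt0//.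
rewrite -!natrX -!natrM ler_nat; nia.
Qed.

Lemma kernel_coef_le m : kernel_coef m <= m.+2%:R^-1.
Proof.
rewrite /kernel_coef expr2 invfM mulrA ler_piMl// ler_pdivrMr// mul1r ler_nat//.
Qed.

(** Summation by parts: the coefficients decrease, so multiplying by [1 - x] leaves two boundary
    terms and a telescoping sum of decrements. *)
Lemma kernel_sum_abel m n x : md x <= 1 ->
  md ((1 - x) * \sum_(m <= k < m + n) (kernel_coef k)%:C * x ^+ k)
    <= 2 * kernel_coef m.
Proof.
move=> x1; set S := fun n => \sum_(m <= k < m + n) (kernel_coef k)%:C * x ^+ k.
have xn1 k : md (x ^+ k) <= 1 by rewrite cmodX exprn_ile1 ?cmod_ge0.
have cx (c : R) k : 0 <= c -> md (c%:C * x ^+ k) <= c.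
  move=> c0; rewrite ComplexField.Normc.normcM cmod_real ger0_norm//.
  by rewrite ler_piMr.
(* Strengthened for the induction: with the boundary term added, each step changes the left side by
   a decrement of the coefficients times a power of [x], and the right side grows by that
   decrement. *)
have H : md ((1 - x) * S n + (kernel_coef (m + n))%:C * x ^+ (m + n))
    <= 2 * kernel_coef m - kernel_coef (m + n).
  elim: n => [|n IH].
    rewrite /S addn0 big_geq// mulr0 add0r.
    rewrite (_ : 2 * _ - _ = kernel_coef m); last by ring.
    exact/cx/kernel_coef_ge0.
  have -> : (1 - x) * S n.+1 + (kernel_coef (m + n.+1))%:C * x ^+ (m + n.+1) =
     ((1 - x) * S n + (kernel_coef (m + n))%:C * x ^+ (m + n)) -
     (kernel_coef (m + n) - kernel_coef (m + n.+1))%:C * x ^+ (m + n).+1.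
    rewrite /S addnS big_nat_recr ?leq_addr//= rmorphB/= exprS; ring.
  apply: (le_trans (cmodD _ _)); rewrite cmodN.
  apply: (le_trans (lerD IH (cx _ (m + n).+1 _))); last by lra.
  by rewrite subr_ge0 addnS kernel_coef_decr.
have -> : (1 - x) * S n =
    ((1 - x) * S n + (kernel_coef (m + n))%:C * x ^+ (m + n)) +
    - ((kernel_coef (m + n))%:C * x ^+ (m + n)) by ring.
apply: (le_trans (cmodD _ _)); rewrite cmodN.
by apply: (le_trans (lerD H (cx _ (m + n)%N (kernel_coef_ge0 (m + n))))); lra.
Qed.

Lemma kernel_sum_ln n : \sum_(0 <= k < n) kernel_coef k <= ln n.+1%:R.
Proof.
elim: n => [|n IH]; first by rewrite big_geq// ln1.
rewrite big_nat_recr//=; apply: (le_trans (lerD IH (kernel_coef_le n))).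
(* The bound [ln (1 + t) <= t] at [t = -1/(n+2)] gives [1/(n+2) <= ln (n+2) - ln (n+1)]. *)
have := @le_ln1Dx R (- n.+2%:R^-1).
have -> : 1 - n.+2%:R^-1 = n.+1%:R / n.+2%:R :> R.
  apply: (mulIf (_ : n.+2%:R != 0)) => //.
  by rewrite mulfVK// mulrBl mulVf// -natr1; ring.
rewrite ln_div ?posrE// ltrN2 invf_lt1// ltr1n => /(_ isT).
by rewrite lerBlDr -lerBlDl opprK addrC.
Qed.

Lemma ln2_lt1 : ln 2 < 1 :> R.
Proof.
rewrite -ltr_expR lnK ?posrE//.
by have := @expR_gt1Dx R 1; rewrite oner_eq0 => /(_ isT).
Qed.

(** For [0 < d <= 2] one has [1 - ln d >= 1 - ln 2 > 0]; hence this constant times [1 - ln d]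
    dominates [2 + ln 3 - ln d], the bound that splitting the kernel sum produces. *)
Definition kernel_const : R := 1 + (2 + ln 3) / (1 - ln 2).

Lemma kernel_const_gt0 : 0 < kernel_const.
Proof.
have := ln2_lt1; have : 0 <= ln 3 :> R by rewrite ln_ge0// ler1n.
move=> l3 l2; have : 0 <= (2 + ln 3) / (1 - ln 2) :> R.
  by rewrite divr_ge0//; lra.
rewrite /kernel_const; lra.
Qed.

(* Up to [1 / |1 - x|] the terms are bounded by a harmonic sum; the remaining
   ones are controlled by summation by parts. *)
Lemma kernel_sum_le n x : md x <= 1 -> x != 1 ->
  md (\sum_(0 <= k < n) (kernel_coef k)%:C * x ^+ k)
    <= kernel_const * ln (expR 1 / md (1 - x)).
Proof.
move=> x1 xn1; set d := md (1 - x).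
have d0 : 0 < d.
  rewrite lt_neqAle cmod_ge0 andbT eq_sym.
  apply/eqP => /ComplexField.Normc.eq0_normc.
  by move/eqP; rewrite subr_eq0 eq_sym (negbTE xn1).
have d2 : d <= 2.
  apply: (le_trans (cmodD _ _)); rewrite cmodN ComplexField.Normc.normc1; lra.
have head p : md (\sum_(0 <= k < p) (kernel_coef k)%:C * x ^+ k) <= ln p.+1%:R.
  apply: le_trans (kernel_sum_ln p); elim: p => [|p IH].
    by rewrite !big_geq// ComplexField.Normc.normc0.
  rewrite !big_nat_recr//=; apply: (le_trans (cmodD _ _)); apply: lerD => //.
  rewrite ComplexField.Normc.normcM cmod_real ger0_norm ?kernel_coef_ge0//.
  by rewrite ler_piMr ?kernel_coef_ge0// cmodX exprn_ile1 ?cmod_ge0.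
rewrite ln_div ?posrE ?expR_gt0// expRK.
(* The cut is at the integer part of [1/d]. Since [d <= 2], [M + 1 <= 1/d + 2/d = 3/d], which bounds
   the head; and [kernel_coef M <= d] cancels the factor [d] in the summation by parts, so the tail
   is at most 2. *)
pose M := Num.trunc d^-1.
have dV0 : 0 <= d^-1 by rewrite invr_ge0 ltW.
have lM : ln M.+1%:R <= ln 3 - ln d.
  rewrite -ln_div ?posrE// ler_ln ?posrE ?divr_gt0// -natr1.
  have : M%:R <= d^-1 by rewrite /M truncn_le.
  have : 1 <= 2 / d by rewrite ler_pdivlMr// mul1r.
  rewrite (_ : 3 / d = d^-1 + 2 / d); first lra.
  by field; rewrite gt_eqF.
have cM : kernel_coef M <= d.
  apply: (le_trans (kernel_coef_le M)).
  have /ltW : d^-1 < M.+1%:R by exact: truncnS_gt.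
  move=> h; rewrite -[leRHS]invrK lef_pV2 ?posrE ?invr_gt0//.
  by rewrite (le_trans h)// ler_nat.
have bound :
    md (\sum_(0 <= k < n) (kernel_coef k)%:C * x ^+ k) <= 2 + ln 3 - ln d.
  have [nM|Mn] := leqP n M.
    apply: (le_trans (head n)); apply: le_trans (_ : ln M.+1%:R <= _).
      by rewrite ler_ln ?posrE// ler_nat.
    lra.
  rewrite (@big_cat_nat _ _ _ M)//= 1?ltnW//; apply: (le_trans (cmodD _ _)).
  have := @kernel_sum_abel M (n - M) x x1; rewrite subnKC 1?ltnW//.
  rewrite ComplexField.Normc.normcM -/d => h.
  have {}h : md (\sum_(M <= k < n) (kernel_coef k)%:C * x ^+ k) <= 2.
    by rewrite -(ler_pM2l d0) (le_trans h)// mulrC ler_pM2r.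
  have := head M; lra.
apply: (le_trans bound); rewrite /kernel_const.
have l2 := ln2_lt1.
have ld : ln d <= ln 2 by rewrite ler_ln ?posrE.
have l3 : 0 <= ln 3 :> R by rewrite ln_ge0// ler1n.
rewrite mulrDl mul1r -lerBlDl -mulrA.
rewrite (_ : 2 + ln 3 - ln d - (1 - ln d) = 1 + ln 3); last by ring.
have : 1 <= (1 - ln 2)^-1 * (1 - ln d).
  by rewrite mulrC ler_pdivlMr; lra.
nra.
Qed.

End kernel_bound.

(** * Continuity and measurability of monomials on [C^2] *)

Section complex_topology.
Variable R : realType.

Lemma Re_continuous : continuous (fun z : Cplx R => complex.Re z : R).
Proof.
move=> z; have FF : Filter (nbhs z) by exact: nbhs_filter.
apply/(@cvgrPdist_lt _ _ _ _ FF) => e e0.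
have e0C : 0 < e%:C :> R[i] by rewrite ltcR.
apply: (@filterS _ (nbhs z) FF _ _ _ (nbhsx_ballx z _ e0C)) => y.
rewrite /ball /= /ball_ /= normc_def ltcR => /(le_lt_trans _); apply.
by rewrite -raddfB -sqrtr_sqr ler_wsqrtr// lerDl sqr_ge0.
Qed.

Lemma Im_continuous : continuous (fun z : Cplx R => complex.Im z : R).
Proof.
move=> z; have FF : Filter (nbhs z) by exact: nbhs_filter.
apply/(@cvgrPdist_lt _ _ _ _ FF) => e e0.
have e0C : 0 < e%:C :> R[i] by rewrite ltcR.
apply: (@filterS _ (nbhs z) FF _ _ _ (nbhsx_ballx z _ e0C)) => y.
rewrite /ball /= /ball_ /= normc_def ltcR => /(le_lt_trans _); apply.
by rewrite -raddfB -sqrtr_sqr ler_wsqrtr// lerDr sqr_ge0.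
Qed.

Definition monom (z : Cplx2 R) (k l : nat) : Cplx R := z.1 ^+ k * z.2 ^+ l.

Lemma cvg_cmul (T : Type) (F : set_system T) (FF : Filter F)
    (u v : T -> Cplx R) (a b : Cplx R) : u @ F --> a -> v @ F --> b ->
  (fun x => u x * v x : Cplx R) @ F --> (a * b : Cplx R).
Proof. by move=> ua vb; exact: (@cvgM R[i] T F FF u v a b ua vb). Qed.

Lemma cvg_real_complex (T : Type) (F : set_system T) (FF : Filter F)
    (u : T -> R) (a : R) : u @ F --> a ->
  (fun x => (u x)%:C : Cplx R) @ F --> (a%:C : Cplx R).
Proof.
move=> ua; apply/cvgrPdist_lt => e; rewrite ltcE /= => /andP[/eqP e1 e2].
move/cvgrPdist_lt : ua => /(_ _ e2); apply: filterS => x.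
rewrite -rmorphB/= normc_def /= expr0n addr0 sqrtr_sqr => h.
by rewrite ltcE /= e1 eqxx.
Qed.

Lemma cvg_cadd (T : Type) (F : set_system T) (FF : Filter F)
    (u v : T -> Cplx R) (a b : Cplx R) : u @ F --> a -> v @ F --> b ->
  (fun x => u x + v x : Cplx R) @ F --> (a + b : Cplx R).
Proof. by move=> ua vb; exact: (@cvgD R[i] R[i]^o T F FF u v a b ua vb). Qed.

Lemma cvg_cexp (T : Type) (F : set_system T) (FF : Filter F)
    (u : T -> Cplx R) (a : Cplx R) n : u @ F --> a ->
  (fun x => u x ^+ n : Cplx R) @ F --> (a ^+ n : Cplx R).
Proof.
move=> ua; elim: n => [|n IH]; first exact: (@cvg_cst (Cplx R)).
under eq_fun do rewrite exprS.
rewrite exprS; exact: (cvg_cmul FF ua IH).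
Qed.

Lemma monom_continuous k l : continuous (fun z : Cplx2 R => monom z k l).
Proof.
move=> z; have FF : Filter (nbhs z) by exact: nbhs_filter.
by apply: (cvg_cmul FF); apply: (cvg_cexp FF); [exact: cvg_fst|exact: cvg_snd].
Qed.

Lemma continuous_measurable (f : Cplx2 R -> R) (D : set (BorelC2 R)) :
  continuous f -> measurable_fun D (f : BorelC2 R -> R).
Proof.
move=> cf; apply: (@measurable_funS _ _ _ _ setT) => //.
apply: (measurability _ (RGenOInfty.measurableE R)) => // _ [_ [a ->] <-].
rewrite setTI; apply: sub_sigma_algebra.
by move/continuousP : cf; apply; exact: interval_open.
Qed.

End complex_topology.

(** * Comparison and linearity of integrals *)

Section integrals.
Context d (T : measurableType d) (R : realType).

(* Unlike [ge0_le_integral], no measurability is required of [f] and [g]: in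
   [riesz_energy] the inner integral is not known to be measurable. *)
Lemma le_integral_subset (mu : {measure set T -> \bar R}) (A S : set T)
    (f g : T -> \bar R) : A `<=` S ->
  (forall x, A x -> (f x <= g x)%E) -> (forall x, S x -> (0 <= g x)%E) ->
  (\int[mu]_(x in A) f x <= \int[mu]_(x in S) g x)%E.
Proof.
move=> AS fg g0.
have H x : ((f \_ A) x <= (g \_ S) x)%E.
  rewrite /patch; case: ifPn => [|_]; last first.
    by case: ifPn => //; rewrite inE => /g0.
  by rewrite inE => Ax; rewrite mem_set; [exact: fg|exact: AS].
(* The integral is a difference of suprema over simple functions below the positive and negative
   parts, and each supremum is monotone in its function. *)
rewrite /integral; apply: leeB; apply: le_ereal_sup => _ [h hf <-];
    exists h => // x; apply: (le_trans (hf x)).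
  by rewrite !funeposE ge_max !le_max H lexx orbT.
by rewrite !funenegE ge_max !le_max leeN2 H lexx orbT.
Qed.

(** The families [u] and [v] will be the real and imaginary parts of the monomials; this form serves
    both variables of the energy integral and the real part of a partial sum. *)
Lemma integral_bilinear (mu : probability T R) (A : set T) (I : Type)
    (r : seq I) (a b : I -> R) (u v : I -> T -> R) : measurable A ->
  (forall i, mu.-integrable A (EFin \o u i)) ->
  (forall i, mu.-integrable A (EFin \o v i)) ->
  (\int[mu]_(x in A) (\sum_(i <- r) (a i * u i x + b i * v i x))%:E)%E =
  (\sum_(i <- r) (a i * Rintegral mu A (u i) + b i * Rintegral mu A (v i)))%:E.
Proof.
move=> mA iu iv.
have iau (c : R) f : mu.-integrable A (EFin \o f) ->
    mu.-integrable A (fun x => (c * f x)%:E).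
  by move=> fi; have := integrableZl mA c fi; apply: eq_integrable.
have iauv i : mu.-integrable A (fun x => (a i * u i x + b i * v i x)%:E).
  apply: (@eq_integrable _ _ _ _ _ _ _
    (fun x => (a i * u i x)%:E + (b i * v i x)%:E)%E) => //.
  by apply: integrableD => //; exact: iau.
under eq_integral do rewrite -sumEFin.
rewrite integral_sum// -sumEFin; apply: eq_bigr => i _.
rewrite -(RintegralZl _ mA)// -(RintegralZl _ mA)// -RintegralD//;
  try exact: iau.
by rewrite /Rintegral fineK//; exact: integrable_fin_num.
Qed.

End integrals.

(** * Moments of a measure bounded by its energy *)

Section energy.
Variable R : realType.

Definition weight (k l : nat) : R :=
  (2 + k + l)%:R ^+ 2 * (k`! * l`!)%:R / ((1 + k + l)`!)%:R.

Lemma weight_gt0 k l : 0 < weight k l.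
Proof.
by rewrite /weight divr_gt0 ?mulr_gt0 ?exprn_gt0// ltr0n ?muln_gt0 ?fact_gt0.
Qed.

(** Indices grouped by total degree [m], the grouping in which the kernel becomes a power series in
    [hinner]; Taylor partial sums run over squares instead. *)
Definition triangle_indices (n : nat) : seq (nat * nat) :=
  [seq ((m - i)%N, i) | m <- iota 0 n, i <- iota 0 m.+1].

Definition square_indices (n : nat) : seq (nat * nat) :=
  [seq (k, l) | k <- iota 0 n, l <- iota 0 n].

Lemma square_indices_uniq n : uniq (square_indices n).
Proof.
by apply: allpairs_uniq; rewrite ?iota_uniq// => -[? ?] [? ?] _ _ [-> ->].
Qed.

Lemma square_sub_triangle n :
  {subset square_indices n <= triangle_indices (n + n)}.
Proof.
move=> p /allpairsP[[k l] /= [+ + ->]]; rewrite !mem_iota => kn ln.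
by apply/allpairsPdep; exists (k + l)%N, l; rewrite !mem_iota addnK;
  split => //; lia.
Qed.

Lemma ler_sum_square (F : nat * nat -> R) n : (forall p, 0 <= F p) ->
  \sum_(p <- square_indices n) F p <= \sum_(p <- triangle_indices (n + n)) F p.
Proof.
move=> F0; move: (square_indices_uniq n) (@square_sub_triangle n).
(* Each entry of the duplicate-free square list is cancelled against one occurrence in the larger
   list; the leftover terms are nonnegative. *)
elim: (square_indices n) (triangle_indices _) => [|x s IH] r /=.
  by move=> _ _; rewrite big_nil sumr_ge0.
move=> /andP[xs us] sr.
have xr : x \in r by rewrite sr ?mem_head.
rewrite big_cons (perm_big _ (perm_to_rem xr))/= big_cons lerD2l.
apply: IH => // y ys; have : y \in r by rewrite sr ?inE ?ys ?orbT.
rewrite (perm_mem (perm_to_rem xr)) inE => /orP[/eqP yx|//].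
by rewrite -yx ys in xs.
Qed.

(** Writing [(m+1)! = (m+1) m!] exposes the binomial coefficient, so in degree [m] the inverse
    weights are the binomial coefficients up to one common factor. *)
Lemma weight_inv m i : (i <= m)%N ->
  (weight (m - i) i)^-1 = kernel_coef R m * 'C(m, i)%:R.
Proof.
move=> im; rewrite /weight /kernel_coef -!addnA subnK// !add1n add2n factS.
rewrite -(bin_fact im) !natrM.
have h k : (k`!)%:R != 0 :> R by rewrite pnatr_eq0 -lt0n fact_gt0.
have hC : 'C(m, i)%:R != 0 :> R by rewrite pnatr_eq0 -lt0n bin_gt0.
by field; rewrite !h hC nat1r -natrD !pnatr_eq0.
Qed.

Lemma conjc_monom (z : Cplx2 R) k l :
  conjc (monom z k l) = conjc z.1 ^+ k * conjc z.2 ^+ l :> R[i].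
Proof.
rewrite -2!(rmorphXn (conjc : {rmorphism R[i] -> R[i]})).
exact: (rmorphM (conjc : {rmorphism R[i] -> R[i]})).
Qed.

(** The binomial theorem for [hinner z y ^+ m], degree by degree. *)
Lemma kernel_expansion n (z y : Cplx2 R) :
  \sum_(p <- triangle_indices n)
     ((weight p.1 p.2)^-1)%:C * (monom z p.1 p.2 * conjc (monom y p.1 p.2)) =
  \sum_(0 <= m < n) (kernel_coef R m)%:C * hinner z y ^+ m :> R[i].
Proof.
rewrite big_allpairs_dep /index_iota subn0; apply: eq_bigr => m _.
rewrite -[iota 0 m.+1]/(index_iota 0 m.+1) big_mkord.
rewrite /hinner exprDn big_distrr/=.
apply: eq_bigr => i _; rewrite weight_inv -1?ltnS// conjc_monom /monom.
rewrite !exprMn rmorphM/= rmorph_nat -mulr_natr; ring.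
Qed.

Lemma cmod_coord_le1 (z : Cplx2 R) : unit_sphere z ->
  ((cmod z.1 : R) <= 1) /\ ((cmod z.2 : R) <= 1).
Proof.
rewrite /unit_sphere/= => h.
split; rewrite -(@expr_le1 _ 2%N) ?cmod_ge0// -h ?lerDl ?lerDr sqr_ge0//.
Qed.

Lemma cmod_monom_le1 (z : Cplx2 R) k l : unit_sphere z ->
  (cmod (monom z k l) : R) <= 1.
Proof.
move=> /cmod_coord_le1[h1 h2]; rewrite ComplexField.Normc.normcM !cmodX.
by rewrite mulr_ile1 ?exprn_ge0 ?exprn_ile1 ?cmod_ge0.
Qed.

Lemma cmod_hinner_le1 (z y : Cplx2 R) : unit_sphere z -> unit_sphere y ->
  (cmod (hinner z y) : R) <= 1.
Proof.
rewrite /unit_sphere/= => hz hy; apply: (le_trans (cmodD _ _)).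
rewrite !ComplexField.Normc.normcM !cmod_conj.
have := sqr_ge0 ((cmod z.1 : R) - cmod y.1).
have := sqr_ge0 ((cmod z.2 : R) - cmod y.2).
rewrite !sqrrB; lra.
Qed.

Lemma Re_mul_conj (x y : R[i]) : complex.Re (x * conjc y) =
  complex.Re x * complex.Re y + complex.Im x * complex.Im y.
Proof. by case: x y => a b [c e] /=; ring. Qed.

(** The real part of the expansion, bounded by [kernel_sum_le] off [hinner z y = 1] and by [+oo]
    there. Each term separates the variables, so that integrating twice yields squares of
    moments. *)
Lemma kernel_le_riesz n (z y : Cplx2 R) : unit_sphere z -> unit_sphere y ->
  ((\sum_(p <- triangle_indices n) (weight p.1 p.2)^-1 / kernel_const R *
     (complex.Re (monom z p.1 p.2) * complex.Re (monom y p.1 p.2) +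
      complex.Im (monom z p.1 p.2) * complex.Im (monom y p.1 p.2)))%:E
   <= riesz_kernel z y)%E.
Proof.
move=> hz hy; rewrite /riesz_kernel; case: ifPn => [_|h]; first exact: leey.
have h1 : hinner z y != 1 by move: h; rewrite subr_eq0 eq_sym.
have := kernel_sum_le n (cmod_hinner_le1 hz hy) h1.
rewrite -kernel_expansion => K.
have {}K := le_trans (le_trans (ler_norm _) (Re_le_cmod _)) K.
rewrite lee_fin -(ler_pM2l (kernel_const_gt0 R)); apply: le_trans K.
rewrite raddf_sum mulr_sumr le_eqVlt; apply/orP; left; apply/eqP.
apply: eq_bigr => p _; rewrite -Re_mul_conj.
rewrite mulrA mulrCA divff ?gt_eqF ?kernel_const_gt0// mulr1.
by case: (_ * conjc _) => a b /=; rewrite mul0r subr0.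
Qed.

Lemma riesz_kernel_ge0 (z y : Cplx2 R) : unit_sphere z -> unit_sphere y ->
  (0 <= riesz_kernel z y)%E.
Proof.
(* For [n = 0] the lower bound is the empty sum. *)
move=> hz hy; have := kernel_le_riesz 0 hz hy.
by rewrite /triangle_indices /= big_nil.
Qed.

Variable mu : probability (BorelC2 R) R.

Lemma integrable_bounded_on_sphere (A : set (BorelC2 R)) (f : Cplx2 R -> R) :
  measurable A -> A `<=` @unit_sphere R -> continuous f ->
  (forall z, unit_sphere z -> `|f z| <= 1) -> mu.-integrable A (EFin \o f).
Proof.
move=> mA AS cf f1; apply: measurable_bounded_integrable => //.
- by rewrite (le_lt_trans (probability_le1 _ mA))// ltry.
- exact: continuous_measurable.
- exists 1; split => // M M1 x /AS /f1 /= h; exact: (le_trans h (ltW M1)).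
Qed.

Lemma integrable_Re_monom (A : set (BorelC2 R)) k l :
  measurable A -> A `<=` @unit_sphere R ->
  mu.-integrable A (EFin \o (fun z : Cplx2 R => complex.Re (monom z k l))).
Proof.
move=> mA AS; apply: integrable_bounded_on_sphere => //.
  move=> z.
  exact: (cvg_comp _ _ (@monom_continuous _ k l z)
    (@Re_continuous _ (monom z k l))).
by move=> z hz; rewrite (le_trans (Re_le_cmod _))// cmod_monom_le1.
Qed.

Lemma integrable_Im_monom (A : set (BorelC2 R)) k l :
  measurable A -> A `<=` @unit_sphere R ->
  mu.-integrable A (EFin \o (fun z : Cplx2 R => complex.Im (monom z k l))).
Proof.
move=> mA AS; apply: integrable_bounded_on_sphere => //.
  move=> z.
  exact: (cvg_comp _ _ (@monom_continuous _ k l z)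
    (@Im_continuous _ (monom z k l))).
by move=> z hz; rewrite (le_trans (Im_le_cmod _))// cmod_monom_le1.
Qed.

Definition Re_moment (A : set (BorelC2 R)) (p : nat * nat) : R :=
  Rintegral mu A (fun z : Cplx2 R => complex.Re (monom z p.1 p.2)).

Definition Im_moment (A : set (BorelC2 R)) (p : nat * nat) : R :=
  Rintegral mu A (fun z : Cplx2 R => complex.Im (monom z p.1 p.2)).

(** [kernel_le_riesz] is integrated over [A] in both variables; enlarging [A] to the sphere only
    increases the right side because the Riesz kernel is nonnegative. The bound is uniform in [A]
    and [n]. *)
Lemma moments_le_energy (A : set (BorelC2 R)) n :
  measurable A -> A `<=` @unit_sphere R ->
  ((\sum_(p <- triangle_indices n) (weight p.1 p.2)^-1 / kernel_const R *
     (Re_moment A p ^+ 2 + Im_moment A p ^+ 2))%:E <= riesz_energy mu)%E.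
Proof.
move=> mA AS.
pose c p := (weight p.1 p.2)^-1 / kernel_const R.
pose u (p : nat * nat) (z : Cplx2 R) : R := complex.Re (monom z p.1 p.2).
pose v (p : nat * nat) (z : Cplx2 R) : R := complex.Im (monom z p.1 p.2).
have iu p : mu.-integrable A (EFin \o u p) by exact: integrable_Re_monom.
have iv p : mu.-integrable A (EFin \o v p) by exact: integrable_Im_monom.
(* The integrand is a finite sum of products of a function of [z] and a function of [y], so each
   integration is explicit. *)
have inner z : (\int[mu]_(y in A)
    (\sum_(p <- triangle_indices n)
      c p * (u p z * u p y + v p z * v p y))%:E)%E =
    (\sum_(p <- triangle_indices n)
      (c p * Re_moment A p * u p z + c p * Im_moment A p * v p z))%:E.
  transitivity (\int[mu]_(y in A) (\sum_(p <- triangle_indices n)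
      (c p * u p z * u p y + c p * v p z * v p y))%:E)%E.
    by apply: eq_integral => y _; congr (_%:E);
      apply: eq_bigr => p _; rewrite mulrDr !mulrA.
  rewrite integral_bilinear//; congr (_%:E); apply: eq_bigr => p _.
  by congr (_ + _); rewrite mulrAC.
have -> : (\sum_(p <- triangle_indices n) (weight p.1 p.2)^-1 / kernel_const R *
     (Re_moment A p ^+ 2 + Im_moment A p ^+ 2))%:E =
  (\int[mu]_(z in A) \int[mu]_(y in A) (\sum_(p <- triangle_indices n)
     c p * (u p z * u p y + v p z * v p y))%:E)%E.
  under eq_integral do rewrite inner.
  rewrite integral_bilinear//; congr (_%:E); apply: eq_bigr => p _.
  by rewrite mulrDr !expr2 !mulrA.
apply: le_integral_subset => // z.
  move=> /AS hz; apply: le_integral_subset => // y;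
    last exact: riesz_kernel_ge0.
  by move=> /AS hy; exact: kernel_le_riesz.
by move=> hz; apply: integral_ge0 => y hy; exact: riesz_kernel_ge0.
Qed.

End energy.

(** Applied twice: to Taylor partial sums at a fixed dilation, and to the radii tending to 1. *)
Lemma fatou_bound d (T : measurableType d) (R : realType)
    (mu : {measure set T -> \bar R}) (D : set T) (f_ : nat -> T -> R)
    (f : T -> R) (c : \bar R) : measurable D ->
  (forall n, measurable_fun D (f_ n)) ->
  (forall n x, D x -> 0 <= f_ n x) ->
  (forall x, D x -> f_ ^~ x @ \oo --> f x) ->
  (forall n, (\int[mu]_(x in D) (f_ n x)%:E <= c)%E) ->
  (\int[mu]_(x in D) (f x)%:E <= c)%E.
Proof.
move=> mD mf f0 ff fc.
have -> : (\int[mu]_(x in D) (f x)%:E)%E =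
    (\int[mu]_(x in D) limn_einf (fun n => (f_ n x)%:E))%E.
  apply: eq_integral => x; rewrite inE => /ff fx.
  have {}fx : (fun n => (f_ n x)%:E) @ \oo --> (f x)%:E.
    by apply: cvg_EFin => //; exact: nearW.
  by rewrite is_cvg_limn_einfE;
    [rewrite (cvg_lim _ fx)|apply/cvg_ex; exists (f x)%:E].
apply: (le_trans (fatou mu mD (f := fun n x => (f_ n x)%:E) _ _)).
- by move=> n; exact/measurable_EFinP.
- by move=> n x Dx; rewrite lee_fin f0.
rewrite limn_einf_lim; apply: lime_le; first exact: is_cvg_einfs.
apply: nearW => n; apply: le_trans (fc n).
by apply: ereal_inf_lbound; exists n => //=.
Qed.

(** * Duality between Taylor coefficients and moments *)

Section dirichlet.
Variable R : realType.

Definition partial_sum (b : nat -> nat -> Cplx R) (n : nat) (z : Cplx2 R) :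
  Cplx R := \sum_(k < n) \sum_(l < n) b k l * z.1 ^+ k * z.2 ^+ l.

Lemma Re_partial_sum b n z : complex.Re (partial_sum b n z) =
  \sum_(p <- square_indices n)
    (complex.Re (b p.1 p.2) * complex.Re (monom z p.1 p.2) +
     - complex.Im (b p.1 p.2) * complex.Im (monom z p.1 p.2)) :> R.
Proof.
have iotaE (V : nmodType) (F : nat -> V) :
    \sum_(k <- iota 0 n) F k = \sum_(k < n) F k.
  by rewrite -(big_mkord xpredT) /index_iota subn0.
rewrite /square_indices big_allpairs iotaE /partial_sum raddf_sum.
apply: eq_bigr => k _; rewrite iotaE raddf_sum; apply: eq_bigr => l _.
rewrite -mulrA -/(monom z k l) /=.
by case: (b k l) (monom z k l) => ? ? [? ?] /=; ring.
Qed.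

Lemma square_sum_le_coef_norm2 (b : nat -> nat -> Cplx R) n :
  ((\sum_(p <- square_indices n) weight R p.1 p.2 * cmod (b p.1 p.2) ^+ 2)%:E
    <= coef_norm2 b)%E.
Proof.
apply: esum_ge; exists [set` square_indices n].
  by split => //; exact: finite_seq.
by rewrite -fsbig_seq ?square_indices_uniq// sumEFin.
Qed.

Lemma Re_partial_sum_continuous b n :
  continuous (fun z : Cplx2 R => complex.Re (partial_sum b n z) : R).
Proof.
under [X in continuous X]eq_fun do rewrite Re_partial_sum.
move=> z.
apply: cvg_big => [x|p _].
  by apply: cvgD; [exact: cvg_fst|exact: cvg_snd].
apply: cvgD; apply: cvgM; try exact: cvg_cst.
  exact: (cvg_comp _ _ (@monom_continuous _ p.1 p.2 z)
    (@Re_continuous _ (monom z p.1 p.2))).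
exact: (cvg_comp _ _ (@monom_continuous _ p.1 p.2 z)
    (@Im_continuous _ (monom z p.1 p.2))).
Qed.

(* Testing against [1_A], [A = {Re P > 0}], turns the integral into a pairing
   of coefficients with the moments of [A]. *)
Lemma integral_positive_part_le (mu : probability (BorelC2 R) R)
    (D : set (BorelC2 R)) (b : nat -> nat -> Cplx R) n (e I : R) :
  measurable D -> D `<=` @unit_sphere R -> 0 < e ->
  (riesz_energy mu <= I%:E)%E ->
  \sum_(p <- square_indices n) weight R p.1 p.2 * cmod (b p.1 p.2) ^+ 2
    <= e ^+ 2 ->
  (\int[mu]_(z in D) (Num.max (complex.Re (partial_sum b n z) : R) 0)%:E
    <= (e * (1 + kernel_const R * I) / 2)%:E)%E.
Proof.
move=> mD DS e0 muI be.
pose A : set (BorelC2 R) :=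
  D `&` [set z | 0 < (complex.Re (partial_sum b n z) : R)].
have mP : measurable_fun D
    ((fun z : Cplx2 R => complex.Re (partial_sum b n z) : R) : BorelC2 R -> R).
  by apply: continuous_measurable; exact: Re_partial_sum_continuous.
have mA : measurable A.
  have := mP mD _ (measurable_itv `]0, +oo[ : measurable (_ : set R)).
  congr measurable; apply/seteqP; split => z /=; rewrite in_itv/= andbT//.
have AS : A `<=` @unit_sphere R by move=> z [/DS].
have -> : (\int[mu]_(z in D)
      (Num.max (complex.Re (partial_sum b n z) : R) 0)%:E)%E =
    (\int[mu]_(z in A) (complex.Re (partial_sum b n z) : R)%:E)%E.
  rewrite integral_mkcond [RHS]integral_mkcond; apply: eq_integral => z _.
  rewrite /patch; case: (boolP (z \in A)) => [|/negP]; rewrite inE /A/=.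
    by move=> [Dz Pz]; rewrite mem_set// max_l// ltW.
  move=> h; case: ifPn => //; rewrite inE => Dz; rewrite max_r// leNgt.
  by apply/negP => Pz; exact: h.
under eq_integral do rewrite Re_partial_sum.
rewrite integral_bilinear//; last 2 first.
- by move=> p; exact: integrable_Re_monom.
- by move=> p; exact: integrable_Im_monom.
rewrite lee_fin.
(* A triangle of size [n + n] contains the square of side [n]. *)
have h := le_trans (moments_le_energy mu (n + n)%N mA AS) muI.
rewrite lee_fin in h.
pose w p := weight R p.1 p.2; pose C := kernel_const R.
have w0 p : 0 < w p by exact: weight_gt0.
have C0 : 0 < C by exact: kernel_const_gt0.
have {}h : \sum_(p <- square_indices n)
    (w p)^-1 * (Re_moment mu A p ^+ 2 + Im_moment mu A p ^+ 2) <= C * I.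
  rewrite -ler_pdivrMl// mulr_sumr; apply: le_trans h.
  under eq_bigr do rewrite mulrA [C^-1 * _]mulrC.
  apply: (ler_sum_square (F := fun p => (w p)^-1 / C *
     (Re_moment mu A p ^+ 2 + Im_moment mu A p ^+ 2))) => p.
  apply: mulr_ge0; last by rewrite addr_ge0 ?sqr_ge0.
  by apply: divr_ge0; [rewrite invr_ge0|]; exact: ltW.
have key : \sum_(p <- square_indices n)
    (complex.Re (b p.1 p.2) * Re_moment mu A p +
     - complex.Im (b p.1 p.2) * Im_moment mu A p) <=
  \sum_(p <- square_indices n) ((2 * e)^-1 * (w p * cmod (b p.1 p.2) ^+ 2) +
     e / 2 * ((w p)^-1 * (Re_moment mu A p ^+ 2 + Im_moment mu A p ^+ 2))).
  apply: ler_sum => p _; rewrite sqr_cmod.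
  (* Weighted arithmetic-geometric mean inequality. The factor [e] balances the two sums: the
     coefficients contribute [e^2 / (2 e)] and the moments [(e / 2) C I]. *)
  have am (x y : R) :
      x * y <= (2 * e)^-1 * (w p * x ^+ 2) + e / 2 * ((w p)^-1 * y ^+ 2).
    rewrite -subr_ge0.
    have -> : (2 * e)^-1 * (w p * x ^+ 2) + e / 2 * ((w p)^-1 * y ^+ 2)
        - x * y =
       (2 * e * w p)^-1 * (w p * x - e * y) ^+ 2.
      by field; rewrite !gt_eqF.
    by rewrite mulr_ge0 ?sqr_ge0// invr_ge0 ltW// !mulr_gt0.
  apply: (le_trans (lerD (am _ _) (am _ _))); rewrite sqrrN; lra.
apply: (le_trans key); rewrite big_split/= -!mulr_sumr.
have e1 : 0 <= (2 * e)^-1 by rewrite invr_ge0 mulr_ge0// ltW.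
have e2 : 0 <= e / 2 by rewrite divr_ge0// ltW.
apply: (le_trans (lerD (ler_wpM2l e1 be) (ler_wpM2l e2 h))).
rewrite le_eqVlt; apply/orP; left; apply/eqP; rewrite /C; field.
by rewrite gt_eqF.
Qed.

End dirichlet.

(** * Radial dilations and limits along them *)

Section noncyclic.
Variable R : realType.

Lemma dirichlet_one : @dirichlet R (fun _ => 1).
Proof.
pose a (k l : nat) : Cplx R := ((k == 0%N) && (l == 0%N))%:R.
have esum_fin (F : nat * nat -> R) : (forall p, 0 <= F p) ->
    (forall p, p <> (0, 0)%N -> F p = 0) ->
    (\esum_(kl in [set: nat * nat]) (F kl)%:E < +oo)%E.
  move=> F0 Fz.
  rewrite (@eq_esum _ _ _ _
      (fun p => if p \in [set (0, 0)%N] then (F p)%:E else 0%E)).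
    by rewrite -esum_mkcond esum_set1 ?lee_fin// ltry.
  by move=> p _; case: ifPn => // /negP; rewrite inE/= => h; rewrite Fz.
have a0 p : p <> (0, 0)%N -> a p.1 p.2 = 0.
  by case: p => [[|k] [|l]].
exists a.
  move=> z _; split.
    apply: esum_fin => [p|p /a0 ->]; first exact: cmod_ge0.
    by rewrite !mul0r ComplexField.Normc.normc0.
  apply: cvg_near_cst; exists 1%N => // -[//|n] _ /=.
  rewrite big_ord_recl big_ord_recl /= !expr0 !mulr1.
  rewrite big1 ?addr0 => [|i _]; last by rewrite /a /= !mul0r.
  by rewrite big1 ?addr0// => i _; rewrite big1// => j _; rewrite /a /= !mul0r.
apply: esum_fin => [p|p /a0 ->].
  by rewrite mulr_ge0 ?sqr_ge0// ltW// weight_gt0.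
by rewrite ComplexField.Normc.normc0 expr0n mulr0.
Qed.

(** Fatou's lemma works along a sequence, so the radial limit is sampled at [1 - 1/(m+1)], which
    stays in [[0, 1)]. *)
Definition radii (m : nat) : R := 1 - harmonic m.

Lemma radii_ge0 m : 0 <= radii m.
Proof. by rewrite subr_ge0 invf_le1// ler1n. Qed.

Lemma radii_lt1 m : radii m < 1.
Proof. by rewrite ltrBlDr ltrDl harmonic_gt0. Qed.

Lemma cvg_radii : radii @ \oo --> (1 : R).
Proof.
rewrite -[X in _ --> X]subr0.
by apply: cvgB; [exact: cvg_cst|exact: cvg_harmonic].
Qed.

Lemma cvg_radii_left : radii @ \oo --> (1 : R)^'-.
Proof.
move=> A hA.
have h : \forall m \near \oo, radii m < 1 -> A (radii m) := cvg_radii hA.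
by apply: filterS h => m; apply; exact: radii_lt1.
Qed.

Definition dilate (s : R) (z : Cplx2 R) : Cplx2 R := (s%:C * z.1, s%:C * z.2).

Lemma dilate_in_ball s z : 0 <= s < 1 -> unit_sphere z ->
  unit_ball (dilate s z).
Proof.
move=> /andP[s0 s1]; rewrite /unit_sphere /unit_ball /= => hz.
rewrite !ComplexField.Normc.normcM !cmod_real ger0_norm// !exprMn -mulrDr hz.
by rewrite mulr1 expr_lt1.
Qed.

(** Dilation becomes multiplication of the coefficients by powers of [s]; for [0 <= s < 1] this does
    not increase the weighted sums. *)
Lemma partial_sum_dilate b n s z : partial_sum b n (dilate s z) =
  partial_sum (fun k l => (s ^+ (k + l))%:C * b k l) n z.
Proof.
apply: eq_bigr => k _; apply: eq_bigr => l _.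
rewrite /= !exprMn exprD rmorphM !rmorphXn/=; ring.
Qed.

(** Along the radii each monomial converges to its value at [z] while [f] tends to 0, so every term
    of the combination tends to 0. *)
Lemma cvg_span_zero (f h : Cplx2 R -> Cplx R) z :
  linear_span (monomial_multiples f) h -> radial_limit_zeros f z ->
  (fun m => h (dilate (radii m) z)) @ \oo --> (0 : Cplx R).
Proof.
move=> [n [c [u [hu ->]]]] [_ fz].
have cf : (fun m => f (dilate (radii m) z)) @ \oo --> (0 : Cplx R).
  exact: (cvg_comp _ _ cvg_radii_left fz).
have rC (y : Cplx R) : (fun m => (radii m)%:C * y : Cplx R) @ \oo --> y.
  have y1 : ((1 : R)%:C * y : Cplx R) = y by exact: (@mul1r R[i] y).
  rewrite -[X in _ --> X]y1.
  exact: (cvg_cmul _ (cvg_real_complex _ cvg_radii)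
    (@cvg_cst (Cplx R) y nat \oo _)).
have cu i : (fun m => c i * u i (dilate (radii m) z) : Cplx R) @ \oo -->
    (0 : Cplx R).
  have [[k l] _ <-] := hu i.
  have cm : (fun m => monom (dilate (radii m) z) k l) @ \oo --> monom z k l.
    rewrite /monom /dilate /=.
    apply: cvg_cmul; apply: cvg_cexp; exact: rC.
  have <- : (c i * (monom z k l * 0) : Cplx R) = 0 by rewrite !mulr0.
  exact: (cvg_cmul _ (@cvg_cst (Cplx R) (c i) nat \oo _) (cvg_cmul _ cm cf)).
elim: (index_enum _) => [|i r IH].
  under [X in X @ _]eq_fun do rewrite big_nil.
  exact: (@cvg_cst (Cplx R)).
have s0 : (0 + 0 : Cplx R) = 0 by rewrite addr0.
rewrite -[X in _ --> X]s0.
under [X in X @ _]eq_fun do rewrite big_cons.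
exact: (cvg_cadd _ (cu i) IH).
Qed.

Lemma cvg_positive_part (u : nat -> R) (a : R) : u @ \oo --> a ->
  (fun n => Num.max (u n) 0) @ \oo --> Num.max a 0.
Proof.
move=> ua; rewrite maxr_absE; under [X in X @ _]eq_fun do rewrite maxr_absE.
apply: cvgM; last exact: cvg_cst.
rewrite subr0 addr0; under [X in X @ _]eq_fun do rewrite subr0 addr0.
by apply: cvgD => //; exact: cvg_norm.
Qed.

Lemma cvg_Re (u : nat -> Cplx R) (a : Cplx R) : u @ \oo --> a ->
  (fun n => complex.Re (u n) : R) @ \oo --> (complex.Re a : R).
Proof. by move=> ua; exact: (cvg_comp _ _ ua (@Re_continuous _ a)). Qed.

(** * Positive part of a dilate: measurability and integral bound *)

Section dilates.
Variables (mu : probability (BorelC2 R) R) (D : set (BorelC2 R)).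
Hypotheses (mD : measurable D) (DS : D `<=` @unit_sphere R).
Variables (g : Cplx2 R -> Cplx R) (b : nat -> nat -> Cplx R) (s : R).
Hypotheses (gb : has_taylor g b) (s01 : 0 <= s < 1).

Let pos (v : Cplx2 R -> Cplx R) : BorelC2 R -> R :=
  fun z => Num.max (complex.Re (v (dilate s z)) : R) 0.

Let measurable_partial n : measurable_fun D (pos (partial_sum b n)).
Proof.
apply: measurable_maxr; last exact: measurable_cst.
have -> : (fun z => complex.Re (partial_sum b n (dilate s z)) : R) =
    (fun z : Cplx2 R => complex.Re (partial_sum
      (fun k l => (s ^+ (k + l))%:C * b k l) n z) : R).
  by apply/funext => z; rewrite partial_sum_dilate.
by apply: continuous_measurable; exact: Re_partial_sum_continuous.
Qed.

Let cvg_partial z : D z -> (fun n => pos (partial_sum b n) z) @ \oo --> pos g z.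
Proof.
move=> Dz; apply: cvg_positive_part; apply: cvg_Re.
by have [] := gb (dilate_in_ball s01 (DS Dz)).
Qed.

(** On [D] the dilated points lie in the ball, where [g] is the pointwise limit of its Taylor
    partial sums. *)
Lemma measurable_dilate : measurable_fun D (pos g).
Proof. exact: (measurable_fun_cvg measurable_partial cvg_partial). Qed.

(** Fatou's lemma carries the duality bound from partial sums to [g]. The bound does not depend on
    [s], which permits the later limit of the radii. *)
Lemma integral_dilate_le (e I : R) : 0 < e -> (riesz_energy mu <= I%:E)%E ->
  (coef_norm2 b <= (e ^+ 2)%:E)%E ->
  (\int[mu]_(z in D) (pos g z)%:E <= (e * (1 + kernel_const R * I) / 2)%:E)%E.
Proof.
move=> e0 muI be.
apply: (fatou_bound mD measurable_partial _ cvg_partial) => [n z _|n].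
  by rewrite le_max lexx orbT.
under eq_integral do rewrite /pos partial_sum_dilate.
apply: integral_positive_part_le => //.
have := le_trans (square_sum_le_coef_norm2 b n) be; rewrite lee_fin.
apply: le_trans; apply: ler_sum => p _; rewrite ler_pM2l ?weight_gt0//.
rewrite ComplexField.Normc.normcM cmod_real exprMn ler_piMl ?sqr_ge0//.
case/andP: s01 => s0 /ltW s1.
by rewrite exprn_ile1// normrX ger0_norm// exprn_ile1.
Qed.

End dilates.

End noncyclic.

(** * The contradiction with cyclicity *)

Theorem theorem4p4 (R : realType) (f : Cplx2 R -> Cplx R)
    (hf : dirichlet f)
    (hcap : (0 < cap2 (radial_limit_zeros f))%E) :
  ~ cyclic_vector f.
Proof.
move=> cyc.
have [mu muE [I I0 muI]] : exists2 mu : probability (BorelC2 R) R,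
    probabilities_on (radial_limit_zeros f) mu &
    exists2 I : R, 0 <= I & (riesz_energy mu <= I%:E)%E.
  move: hcap; rewrite /cap2; set S := [set riesz_energy mu | mu in _] => hc.
  (* An infimum equal to [+oo] would have inverse 0, against the positive capacity. *)
  have : (ereal_inf S < +oo)%E.
    by rewrite ltey; apply: contraTneq hc => ->; rewrite invey ltxx.
  move=> /ereal_inf_lt[_ [mu muE <-] muoo]; exists mu => //.
  have : (0 <= riesz_energy mu)%E.
    apply: integral_ge0 => z hz; apply: integral_ge0 => y hy.
    exact: riesz_kernel_ge0.
  case: (riesz_energy mu) muoo => [r _|//|//]; rewrite lee_fin => r0.
  by exists r.
have [N [mN N0 EN]] := muE.
(* The almost-everywhere condition yields a measurable null set [N]; its complement is a measurable
   set of full measure inside the zero set, on which the integrals are taken. *)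
pose D : set (BorelC2 R) := ~` N.
have mD : measurable D by exact: measurableC.
have DE z : D z -> radial_limit_zeros f z.
  by move=> Dz; apply: contrapT => nE; apply: Dz; exact: EN.
have DS : D `<=` @unit_sphere R by move=> z /DE[].
have muD : mu D = 1%E by rewrite /D probability_setC// N0 sube0.
pose K := 1 + kernel_const R * I.
have K0 : 0 < K.
  have := mulr_ge0 (ltW (kernel_const_gt0 R)) I0; rewrite /K; lra.
(* With this choice the duality bound [e * K / 2] equals [1/2], below the total mass 1 of [D]. *)
pose e := K^-1.
have e0 : 0 < e by rewrite invr_gt0.
have : dirichlet_closure (linear_span (monomial_multiples f))
    (fun _ => 1 : Cplx R).
  by rewrite cyc; exact: dirichlet_one.
move=> [_ /(_ e e0)[h hh]].
(* An infimum below [e^2] supplies actual Taylor coefficients [b] of [g = 1 - h] whose norm obeys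
   the bound. *)
set g := fun z => _ => /ereal_inf_lt[_ [b gb <-] be].
have r01 m : 0 <= radii R m < 1 by rewrite radii_ge0 radii_lt1.
have fin : (\int[mu]_(z in D) (1 : R)%:E <= (e * K / 2)%:E)%E.
  apply: (@fatou_bound _ _ _ _ _
    (fun m (z : BorelC2 R) =>
      Num.max (complex.Re (g (dilate (radii R m) z)) : R) 0)
    (fun _ => 1)) => //.
  - by move=> m; exact: (measurable_dilate DS gb (r01 m)).
  - by move=> m z _; rewrite le_max lexx orbT.
  - move=> z /DE zE.
    have one : Num.max (complex.Re (1 - 0 : Cplx R) : R) 0 = 1.
      by rewrite /= subr0 max_l.
    rewrite -[X in _ --> X]one; apply: cvg_positive_part; apply: cvg_Re.
    exact: (@cvgB R[i] R[i]^o nat \oo _ (fun=> 1) _ 1 0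
      (@cvg_cst (Cplx R) 1 nat \oo _) (cvg_span_zero hh zE)).
  - by move=> m; apply: (integral_dilate_le mD DS gb (r01 m)) => //; exact: ltW.
have i1 : (\int[mu]_(z in D) (1 : R)%:E = 1)%E.
  transitivity (1 * mu D)%E; last by rewrite muD mule1.
  exact: (integral_cst mu mD 1%E).
move: fin; rewrite i1 lee_fin /e mulVf ?gt_eqF//; lra.
Qed.
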